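(* Let $n,r,s \in \mathbb{Z}^+$ with $n \geq rs$, and let $M$ be a left $S(n,r)$-module. Then $$f_{rs}\, M^{\otimes s} \;\cong\; \operatorname{Ind}_{\mathfrak{S}_r \wr \mathfrak{S}_s}^{\mathfrak{S}_{rs}}\big((f_r M)^{\otimes s} \otimes_F F\mathfrak{S}_s\big) = F\mathfrak{S}_{rs}\otimes_{F(\mathfrak{S}_r\wr\mathfrak{S}_s)}\big((f_r M)^{\otimes s} \otimes_F F\mathfrak{S}_s\big)$$ as $(F\mathfrak{S}_{rs}, F\mathfrak{S}_s)$-bimodules.
   Context: $F$ is an infinite field of arbitrary characteristic; permutations are composed from right to left. $\Lambda(n,r)$ is the set of compositions of $r$ into $n$ parts. Let $V=F^n$ with basis $v_1,\dots,v_n$; the Schur algebra $S(n,r)=\mathrm{End}_{F\mathfrak{S}_r}(V^{\otimes r})$, and $e_r:F\mathrm{GL}_n(F)\to S(n,r)$ is the surjective homomorphism given by the diagonal action of $g$ on $V^{\otimes r}$. For $\alpha\in\Lambda(n,r)$, $\xi_\alpha$ is the weight idempotent (projection onto the span of basis tensors $v_{i_1}\otimes\cdots\otimes v_{i_r}$ in which $j$ occurs $\alpha_j$ times), and $M^\alpha=\xi_\alpha M$. If $M_1,M_2$ are left $S(n,r)$- and $S(n,s)$-modules, $M_1\otimes_F M_2$ is the left $S(n,r+s)$-module with $e_{r+s}(g)(m_1\otimes m_2)=e_r(g)m_1\otimes e_s(g)m_2$ for $g\in \mathrm{GL}_n(F)$; in particular $M^{\otimes s}$ is a left $S(n,rs)$-module,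 and it carries a commuting right $\mathfrak{S}_s$-action by place permutations $(m_1\otimes\cdots\otimes m_s)\cdot\sigma = m_{\sigma(1)}\otimes\cdots\otimes m_{\sigma(s)}$. For $n\ge r$ let $\omega_r=(1,\dots,1,0,\dots,0)\in\Lambda(n,r)$ ($r$ ones). The Schur functor $f_r$ sends a left $S(n,r)$-module $M$ to $f_rM = M^{\omega_r}$, a left $F\mathfrak{S}_r$-module via $\sigma\cdot m = e_r(\sigma)m$, where $\mathfrak{S}_r\subseteq\mathfrak{S}_n\subseteq \mathrm{GL}_n(F)$ as permutation matrices ($\sigma v_i=v_{\sigma(i)}$). Thus $f_{rs}M^{\otimes s}$ is an $(F\mathfrak{S}_{rs},F\mathfrak{S}_s)$-bimodule. For $1\le i\le s$ and $\sigma\in\mathfrak{S}_r$, $\sigma[i]\in\mathfrak{S}_{rs}$ sends $(i-1)r+j$ to $(i-1)r+\sigma(j)$ for $1\le j\le r$ and fixes all other points; for $\tau\in\mathfrak{S}_s$, $\tau^{[r]}\in\mathfrak{S}_{rs}$ sends $(i-1)r+j$ to $(\tau(i)-1)r+j$. The wreath product $\mathfrak{S}_r\wr\mathfrak{S}_s$ is identified with the subgroup $\big(\prod_{i=1}^s\{\sigma[i]:\sigma\in\mathfrak{S}_r\}\big)\{\tau^{[r]}:\tau\in\mathfrak{S}_s\}$ of $\mathfrak{S}_{rs}$, writing elements as $(\sigma_1,\dots,\sigma_s)\tau$. $(f_rM)^{\otimes s}$ is a left $F(\mathfrak{S}_r\wr\mathfrak{S}_s)$-module via $(\sigma_1,\dots,\sigma_s)\tau\cdot(m_1\otimes\cdots\otimes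 m_s)=\sigma_1m_{\tau^{-1}(1)}\otimes\cdots\otimes\sigma_sm_{\tau^{-1}(s)}$, made into an $(F(\mathfrak{S}_r\wr\mathfrak{S}_s),F\mathfrak{S}_s)$-bimodule with $\mathfrak{S}_s$ acting trivially on the right; $F\mathfrak{S}_s$ is an $(F(\mathfrak{S}_r\wr\mathfrak{S}_s),F\mathfrak{S}_s)$-bimodule with $(\mathfrak{S}_r)^s$ acting trivially on the left and $\mathfrak{S}_s$ by left and right multiplication. $(f_rM)^{\otimes s}\otimes_F F\mathfrak{S}_s$ is given the diagonal bimodule structure, and the induced module carries the left $F\mathfrak{S}_{rs}$-action by multiplication and the right $F\mathfrak{S}_s$-action inherited from the second factor. *)

(* Defs.v *)
From HB Require Import structures.
From mathcomp Require Import all_boot all_order all_algebra all_fingroup.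
Unset Printing Implicit Defensive.
Import GRing.Theory.
Local Open Scope ring_scope.

Section SchurDefs.
Variable F : fieldType.

Definition infinite_field : Prop := forall l : seq F, exists x : F, x \notin l.

(** Paper's composition of permutations (right to left): (pc g h) x = g (h x).
    (MathComp's (h * g)%g is "h first, then g".) *)
Definition pc {T : finType} (g h : {perm T}) : {perm T} := (h * g)%g.

Definition papp {k : nat} (p : 'S_k) (x : nat) : nat :=
  match (insub x : option 'I_k) with Some i => val (p i) | None => x end.

(** the permutation matrix of p in S_k <= S_n <= GL_n(F): p v_b = v_{p(b)} *)
Definition pmx (n k : nat) (p : 'S_k) : 'M[F]_n :=
  \matrix_(a < n, b < n) ((val a == papp p (val b))%:R : F).

(** basis of V^{⊗r}: v_{i_1} ⊗ ... ⊗ v_{i_r}, indexed by i : 'I_r -> 'I_n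
    (0-indexed) *)
Definition tidx (n r : nat) := {ffun 'I_r -> 'I_n}.

(** F-linear endomorphisms of V^{⊗r}, as matrices w.r.t. this basis:
    A v_j = \sum_i A (i, j) v_i *)
Definition endo (n r : nat) := {ffun (tidx n r * tidx n r) -> F}.

Definition emul {n r} (A B : endo n r) : endo n r :=
  [ffun ij => \sum_(k : tidx n r) A (ij.1, k) * B (k, ij.2)].
Definition eone n r : endo n r := [ffun ij => ((ij.1 == ij.2) : bool)%:R].
Definition elc {n r} (a : F) (A B : endo n r) : endo n r :=
  [ffun ij => a * A ij + B ij].

(** place permutations: (v_{i_1} ⊗ ... ⊗ v_{i_r}) . π = v_{i_{π(1)}} ⊗ ... *)
Definition pplace {n r} (i : tidx n r) (pi : 'S_r) : tidx n r := [ffun k => i (pi k)].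

(** S(n,r) = End_{F S_r}(V^{⊗r}) *)
Definition in_schur {n r} (A : endo n r) : Prop :=
  forall (pi : 'S_r) (i j : tidx n r), A (pplace i pi, pplace j pi) = A (i, j).

(** e_r(g): the diagonal action of g in GL_n(F) on V^{⊗r} *)
Definition er n r (g : 'M[F]_n) : endo n r :=
  [ffun ij : tidx n r * tidx n r => \prod_(k < r) g (ij.1 k) (ij.2 k)].

Definition wt {n r} (i : tidx n r) (a : 'I_n) : nat := #|[set k | i k == a]|.
Definition xi n r (alpha : 'I_n -> nat) : endo n r :=
  [ffun ij => ((ij.1 == ij.2) && [forall a, wt ij.1 a == alpha a] : bool)%:R].
Definition omega n (r : nat) : 'I_n -> nat := fun a => nat_of_bool (val a < r)%N.

Definition islin {U W : lmodType F} (f : U -> W) : Prop :=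
  forall (a : F) (x y : U), f (a *: x + y) = a *: f x + f y.

Definition is_smod n r {M : lmodType F} (act : endo n r -> M -> M) : Prop :=
  [/\ forall A, in_schur A -> islin (act A),
      forall A B (a : F) m, in_schur A -> in_schur B ->
        act (elc a A B) m = a *: act A m + act B m,
      forall A B m, in_schur A -> in_schur B -> act (emul A B) m = act A (act B m)
    & forall m, act (eone n r) m = m].

(** the Schur functor on objects: f_r M = xi_{omega_r} M *)
Definition fimg n r {M : lmodType F} (act : endo n r -> M -> M) (m : M) : Prop :=
  exists m' : M, m = act (xi n r (omega n r)) m'.

(** tensor powers: universal multilinear maps.  P is the subspace of M
    whose s-th tensor power is taken (P = everything for M^{⊗s}). *)
Definition upd {s : nat} {M : Type} (m : {ffun 'I_s -> M}) (i : 'I_s) (x : M) :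
  {ffun 'I_s -> M} := [ffun j => if j == i then x else m j].

Definition multilin {s : nat} {M W : lmodType F} (P : M -> Prop)
  (h : {ffun 'I_s -> M} -> W) : Prop :=
  forall (m : {ffun 'I_s -> M}) (i : 'I_s) (a : F) (x y : M),
    (forall j, P (m j)) -> P x -> P y ->
    h (upd m i (a *: x + y)) = a *: h (upd m i x) + h (upd m i y).

Definition is_tensor_power {s : nat} {M T : lmodType F} (P : M -> Prop)
  (t : {ffun 'I_s -> M} -> T) : Prop :=
  multilin P t /\
  forall (W : lmodType F) (h : {ffun 'I_s -> M} -> W), multilin P h ->
    exists phi : T -> W,
      [/\ islin phi,
          forall m : {ffun 'I_s -> M}, (forall j, P (m j)) -> phi (t m) = h m
        & forall psi : T -> W, islin psi ->
            (forall m : {ffun 'I_s -> M}, (forall j, P (m j)) -> psi (t m) = h m) ->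
            forall x, psi x = phi x].

(** the element (sigma_1,...,sigma_s) tau = (prod_i sigma_i[i]) tau^[r]
    of S_r wr S_s <= S_{rs}, on 0-indexed points:
    q*r + j |-> tau(q)*r + sigma_{tau(q)}(j) *)
Definition wr_val {r s : nat} (sigma : {ffun 'I_s -> 'S_r}) (tau : 'S_s) (x : nat)
  : nat :=
  match (insub (x %/ r)%N : option 'I_s), (insub (x %% r)%N : option 'I_r) with
  | Some q, Some j => (val (tau q) * r + val (sigma (tau q) j))%N
  | _, _ => x
  end.
Definition is_wr {r s : nat} (h : 'S_(r * s)) (sigma : {ffun 'I_s -> 'S_r})
  (tau : 'S_s) : Prop := forall x : 'I_(r * s), val (h x) = wr_val sigma tau (val x).

(** F S_{rs} ⊗_F ((f_r M)^{⊗s} ⊗_F F S_s), written as functions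
    u : S_{rs} x S_s -> (f_r M)^{⊗s}, u = \sum_{g,k} delta_g ⊗ (u(g,k) ⊗ delta_k) *)
Definition single {G K : finType} {T : lmodType F} (g : G) (k : K) (y : T)
  : {ffun G * K -> T} := [ffun p => if p == (g, k) then y else 0].

(** left S_{rs}-action: g'.(delta_g ⊗ y) = delta_{g' g} ⊗ y *)
Definition indl {G K : finType} {T : lmodType F} (g' : {perm G})
  (u : {ffun {perm G} * {perm K} -> T}) : {ffun {perm G} * {perm K} -> T} :=
  [ffun p => u (pc (g'^-1)%g p.1, p.2)].
(** right S_s-action: (delta_g ⊗ (y ⊗ delta_k)).tau = delta_g ⊗ (y ⊗ delta_{k tau}) *)
Definition indr {G K : finType} {T : lmodType F} (tau : {perm K})
  (u : {ffun {perm G} * {perm K} -> T}) : {ffun {perm G} * {perm K} -> T} :=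
  [ffun p => u (p.1, pc p.2 (tau^-1)%g)].

Definition lspan {U : lmodType F} (P : U -> Prop) (z : U) : Prop :=
  forall W : U -> Prop, W 0 -> (forall (a : F) x y, W x -> W y -> W (a *: x + y)) ->
    (forall x, P x -> W x) -> W z.

End SchurDefs.

(* Main.v *)
Require Import Defs.
From HB Require Import structures.
From mathcomp Require Import all_boot all_order all_algebra all_fingroup.
From mathcomp Require Import zify.
Import GRing.Theory.
Local Open Scope ring_scope.
Set Implicit Arguments.
Unset Strict Implicit.

(** Let theta send m_1 ⊗ ... ⊗ m_s, with all m_q of weight omega_r, to the tensor in
    which m_q is moved by v_j |-> v_{(q-1)r+j} into the q-th block of r basis vectors.
    Then Phi (g ⊗ (y ⊗ k)) = (g theta y) k, and moving blocks by an element of the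
    wreath product shows that Phi is balanced.

    A tensor of weight vectors has a weight that is the sum of theirs; over an infinite
    field the weight idempotents are combinations of diagonal torus elements, on which
    the action on M^{⊗s} is known.  If the total weight is omega_{rs}, the supports of
    the factors form an ordered partition of {1,...,rs} into s sets of size r, so a
    permutation carries the tensor to the image of theta: Phi is surjective.

    For the kernel, choose a representative (g0, k0) for each such ordered partition and
    send y to the sum of g0 ⊗ (pi (g0^-1 y k0^-1) ⊗ k0), where pi moves the q-th factor
    back from the q-th block and projects to weight omega_r.  A summand g ⊗ (y ⊗ k) is
    killed by every representative but its own, from which it is recovered modulo the
    balancing relations. *)

(** * Linear maps, finitely supported sums and spans *)

Section LinearMaps.
Variable F : fieldType.
Implicit Types U V W : lmodType F.

Lemma islin0 U W (f : U -> W) : islin F f -> f 0 = 0.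
Proof.
by move=> lf; have := lf (-1) 0 0; rewrite scaler0 addr0 scaleN1r addNr.
Qed.

Lemma islinD U W (f : U -> W) x y : islin F f -> f (x + y) = f x + f y.
Proof. by move=> lf; rewrite -[x in LHS]scale1r lf scale1r. Qed.

Lemma islinZ U W (f : U -> W) a x : islin F f -> f (a *: x) = a *: f x.
Proof. by move=> lf; rewrite -[X in f X]addr0 lf (islin0 lf) addr0. Qed.

Lemma islin_sum U W (f : U -> W) (I : Type) (s : seq I) (P : pred I) (E : I -> U) :
  islin F f -> f (\sum_(i <- s | P i) E i) = \sum_(i <- s | P i) f (E i).
Proof.
by move=> lf; apply: (big_morph f (fun x y => islinD x y lf) (islin0 lf)).
Qed.

Lemma islin_comp U V W (f : V -> W) (g : U -> V) :
  islin F f -> islin F g -> islin F (f \o g).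
Proof. by move=> lf lg a x y /=; rewrite lg lf. Qed.

Lemma islin_bigsum U W (I : Type) (s : seq I) (P : pred I) (f : I -> U -> W) :
  (forall i, islin F (f i)) -> islin F (fun x => \sum_(i <- s | P i) f i x).
Proof.
move=> lf a x y; rewrite scaler_sumr -big_split /=.
by apply: eq_bigr => i _; rewrite lf.
Qed.

Lemma islin_single (G K : finType) U (g : G) (k : K) : islin F (@single F G K U g k).
Proof.
move=> a x y; apply/ffunP => p; rewrite !ffunE.
by case: eqP => _; rewrite // scaler0 addr0.
Qed.

Lemma ffun_sum_single (G K : finType) U (u : {ffun G * K -> U}) :
  u = \sum_p single F p.1 p.2 (u p).
Proof.
apply/ffunP => q; rewrite sum_ffunE (bigD1 q) //= ffunE -surjective_pairing eqxx.
by rewrite big1 ?addr0 // => p pq; rewrite ffunE -surjective_pairing eq_sym (negPf pq).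
Qed.

Lemma lspan0 U (P : U -> Prop) : lspan F P 0.
Proof. by move=> W W0 _ _. Qed.

Lemma lspanD U (P : U -> Prop) x y : lspan F P x -> lspan F P y -> lspan F P (x + y).
Proof.
move=> Px Py W W0 WD WP; rewrite -[x]scale1r.
exact: (WD 1 x y (Px W W0 WD WP) (Py W W0 WD WP)).
Qed.

Lemma lspan_sum U (P : U -> Prop) (I : Type) (s : seq I) (Q : pred I) (E : I -> U) :
  (forall i, Q i -> lspan F P (E i)) -> lspan F P (\sum_(i <- s | Q i) E i).
Proof.
move=> H; apply: (big_ind (lspan F P) (@lspan0 _ P)) H.
exact: (@lspanD _ P).
Qed.

Lemma lspan_ker U W (f : U -> W) (P : U -> Prop) u :
  islin F f -> (forall x, P x -> f x = 0) -> lspan F P u -> f u = 0.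
Proof.
move=> lf fP /(_ (fun x => f x = 0)) H; apply: H => //; first exact: islin0.
by move=> a x y fx fy; rewrite lf fx fy scaler0 addr0.
Qed.

End LinearMaps.

(** * Multilinear maps and tensor powers *)

Section Multilinear.
Variables (F : fieldType) (s : nat) (M : lmodType F).
Implicit Types (W T : lmodType F) (P Q : M -> Prop).

Lemma multilin_comp P T W (h : {ffun 'I_s -> M} -> T) (f : T -> W) :
  multilin F P h -> islin F f -> multilin F P (f \o h).
Proof. by move=> mh lf m i a x y Pm Px Py /=; rewrite mh // lf. Qed.

(** Serves to build [theta] and [pi], where each slot is moved by its own linear map. *)
Lemma multilin_map P Q T (h : {ffun 'I_s -> M} -> T) (L : 'I_s -> M -> M) :
  (forall i, islin F (L i)) -> (forall i x, Q x -> P (L i x)) ->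
  multilin F P h -> multilin F Q (fun m => h [ffun i => L i (m i)]).
Proof.
move=> lL PL mh m i a x y Qm Qx Qy.
have E z : [ffun j => L j (upd m i z j)] = upd [ffun j => L j (m j)] i (L i z).
  by apply/ffunP => j; rewrite !ffunE; case: eqP => [->|].
rewrite !E lL mh //; try exact: PL.
by move=> j; rewrite ffunE; apply: PL.
Qed.

(** The uniqueness half of the universal property. *)
Lemma tensor_ext P T W (t : {ffun 'I_s -> M} -> T) (f g : T -> W) :
  is_tensor_power F P t -> islin F f -> islin F g ->
  (forall m : {ffun 'I_s -> M}, (forall j, P (m j)) -> f (t m) = g (t m)) -> f =1 g.
Proof.
move=> [mt ut] lf lg fg x.
have [phi [_ _ uphi]] := ut W (f \o t) (multilin_comp mt lf).
by rewrite (uphi f) // (uphi g) // => m Pm; rewrite /= fg.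
Qed.

Lemma multilin_slot T (h : {ffun 'I_s -> M} -> T) m i :
  multilin F (fun _ => True) h -> islin F (fun x => h (upd m i x)).
Proof. by move=> mh a x y; rewrite mh. Qed.

Lemma upd_id (m : {ffun 'I_s -> M}) i : upd m i (m i) = m.
Proof. by apply/ffunP => j; rewrite ffunE; case: eqP => [->|]. Qed.

Lemma multilin_ext_decomp T (B : finType) (e : B -> M -> M)
    (h1 h2 : {ffun 'I_s -> M} -> T) :
  multilin F (fun _ => True) h1 -> multilin F (fun _ => True) h2 ->
  (forall x, x = \sum_b e b x) ->
  (forall m : {ffun 'I_s -> M}, (forall i, exists b x, m i = e b x) -> h1 m = h2 m) -> h1 =1 h2.
Proof.
move=> mh1 mh2 dec H m.
(* Induction on [k]: slots below [k] are still arbitrary, the others are already components. *)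
suff: forall k, (k <= s)%N -> forall m : {ffun 'I_s -> M},
    (forall i : 'I_s, (k <= i)%N -> exists b x, m i = e b x) -> h1 m = h2 m.
  by move/(_ s (leqnn s) m); apply => i; rewrite leqNgt ltn_ord.
elim=> [_ {}m Hm|k IH ks {}m Hm]; first by apply: H => i; apply: Hm.
pose i0 := Ordinal ks.
rewrite -(upd_id m i0) (dec (m i0)).
rewrite (islin_sum _ _ _ (multilin_slot m i0 mh1)).
rewrite (islin_sum _ _ _ (multilin_slot m i0 mh2)).
apply: eq_bigr => b _; apply: (IH (ltnW ks)) => i ki; rewrite ffunE.
case: (eqVneq i i0) => [_|ne]; first by exists b, (m i0).
by apply: Hm; rewrite ltn_neqAle ki andbT eq_sym.
Qed.

End Multilinear.

(** * Weights, weight idempotents and group elements in the Schur algebra *)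

Section SchurAlgebra.
Variables (F : fieldType) (n r : nat).
Implicit Types (A B : endo F n r) (i j J : tidx n r).

Lemma wt_pplace i (p : 'S_r) a : wt (pplace i p) a = wt i a.
Proof.
rewrite /wt -(card_imset _ (@perm_inj _ p)); apply: eq_card => k.
rewrite inE; apply/imsetP/eqP => [[k' + ->]|<-]; first by rewrite inE ffunE => /eqP.
by exists (p^-1%g k); rewrite ?permKV // inE ffunE permKV.
Qed.

(** Equal weights mean equal multisets of indices, hence a rearrangement of places. *)
Lemma eq_wtP i j : reflect (exists p : 'S_r, j = pplace i p) [forall a, wt j a == wt i a].
Proof.
apply: (iffP forallP) => [H|[p ->] a]; last by rewrite wt_pplace.
have: perm_eq [tuple j k | k < r] [tuple i k | k < r].
  apply/allP => a _; rewrite /= !count_map.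
  have E (k : tidx n r) : count (preim k (pred1 a)) (Finite.enum 'I_r) = wt k a.
    by rewrite /wt cardsE cardE -size_filter [in RHS]/enum_mem; congr size.
  by apply/eqP; rewrite [LHS]E [RHS]E; apply/eqP/H.
move=> /tuple_permP [p /val_inj Hp]; exists p; apply/ffunP => k; rewrite ffunE.
by have := congr1 (fun l => tnth l k) Hp; rewrite !tnth_mktuple.
Qed.

(** Naming a weight by a basis tensor [J] restricts to weights that occur and gives a column to
    compute with. *)
Definition xw J : endo F n r := xi F n r (wt J).

Lemma xwE J i j : xw J (i, j) = ((i == j) && [forall a, wt i a == wt J a])%:R.
Proof. by rewrite ffunE. Qed.

Lemma pplace_inj (p : 'S_r) : injective (fun i => pplace i p).
Proof.
move=> i j /ffunP E; apply/ffunP => k.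
by have := E (p^-1%g k); rewrite !ffunE permKV.
Qed.

Lemma in_schur_xi a : in_schur F (xi F n r a).
Proof.
move=> p i j; rewrite !ffunE /= (inj_eq (@pplace_inj p)).
by under eq_forallb do rewrite wt_pplace.
Qed.

Lemma in_schur_er g : in_schur F (er F n r g).
Proof.
move=> p i j; rewrite !ffunE /= [RHS](reindex_inj (@perm_inj _ p)) /=.
by apply: eq_bigr => k _; rewrite !ffunE.
Qed.

Lemma in_schur_emul A B : in_schur F A -> in_schur F B -> in_schur F (emul F A B).
Proof.
move=> sA sB p i j; rewrite !ffunE /= (reindex (fun k => pplace k p)) /=.
  by apply: eq_bigr => k _; rewrite sA sB.
exists (fun k => pplace k p^-1%g) => k _; apply/ffunP => x; rewrite !ffunE.
  by rewrite permKV.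
by rewrite permK.
Qed.

Lemma emul_xil a A i j :
  emul F (xi F n r a) A (i, j) = [forall b, wt i b == a b]%:R * A (i, j).
Proof.
rewrite ffunE /= (bigD1 i) //= ffunE /= eqxx big1 ?addr0 // => k ki.
by rewrite ffunE /= eq_sym (negPf ki) mul0r.
Qed.

Lemma emul_xir a A i j :
  emul F A (xi F n r a) (i, j) = A (i, j) * [forall b, wt j b == a b]%:R.
Proof.
rewrite ffunE /= (bigD1 j) //= ffunE /= eqxx big1 ?addr0 // => k ki.
by rewrite ffunE /= (negPf ki) mulr0.
Qed.

Lemma emul_er g h : emul F (er F n r g) (er F n r h) = er F n r (g *m h).
Proof.
apply/ffunP => -[i j]; rewrite !ffunE /=.
under [RHS]eq_bigr do rewrite mxE.
rewrite bigA_distr_bigA /=; apply: eq_bigr => k _.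
by rewrite !ffunE /= big_split.
Qed.

Lemma er1 : er F n r 1%:M = eone F n r.
Proof.
apply/ffunP => -[i j]; rewrite !ffunE /=.
case: eqVneq => [->|ne].
  by rewrite big1 // => k _; rewrite mxE eqxx.
have [k Hk] : exists k, i k != j k.
  apply/existsP; apply: contraR ne => /existsPn H; apply/eqP/ffunP => k.
  by apply/eqP; rewrite -[_ == _]negbK.
by rewrite (bigD1 k) //= mxE (negPf Hk) mul0r.
Qed.

End SchurAlgebra.

(** * Modules over the Schur algebra *)

Section SchurModule.
Variables (F : fieldType) (n r : nat) (M : lmodType F) (act : endo F n r -> M -> M).
Hypothesis Hact : is_smod F n r act.
Implicit Types (A B : endo F n r) (J : tidx n r) (m : M).

Lemma smod_lin A : in_schur F A -> islin F (act A).
Proof. by have [+ _ _ _] := Hact; apply. Qed.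

Lemma smod_mul A B m :
  in_schur F A -> in_schur F B -> act A (act B m) = act (emul F A B) m.
Proof. by case: Hact => _ _ H _ sA sB; rewrite H. Qed.

Lemma smod_er g h m :
  act (er F n r g) (act (er F n r h) m) = act (er F n r (g *m h)) m.
Proof. by rewrite smod_mul ?emul_er //; apply: in_schur_er. Qed.

Lemma smod_er1 m : act (er F n r 1%:M) m = m.
Proof. by rewrite er1; case: Hact. Qed.

Lemma smod0 A m : (forall ij, A ij = 0) -> act A m = 0.
Proof.
move=> A0; have [_ Hlc _ _] := Hact.
have sA : in_schur F A by move=> p i j; rewrite !A0.
(* A zero matrix equals [-A + A], and linearity in [A] makes its action zero. *)
have EA : elc F (-1) A A = A by apply/ffunP => ij; rewrite ffunE !A0 mulr0 addr0.
by rewrite -EA Hlc // scaleN1r addNr.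
Qed.

Lemma smod_lc (I : finType) (c : I -> F) (E : I -> endo F n r) A m :
  (forall l, in_schur F (E l)) -> (forall ij, A ij = \sum_l c l * E l ij) ->
  act A m = \sum_l c l *: act (E l) m.
Proof.
move=> sE HA; case: Hact => _ Hlc _ _.
have -> : A = [ffun ij => \sum_l c l * E l ij] by apply/ffunP => ij; rewrite ffunE.
elim: (index_enum I) => [|l e IH].
  by rewrite big_nil smod0 // => ij; rewrite ffunE big_nil.
rewrite big_cons -IH -Hlc //; last first.
  move=> p i j; rewrite !ffunE; apply: eq_bigr => k _; congr (_ * _); exact: sE.
by congr (act _ _); apply/ffunP => ij; rewrite !ffunE big_cons.
Qed.

(** Each basis tensor has exactly one weight, with entries at most [r]; hence the values in
    ['I_r.+1]. *)
Lemma smod_sum_xi m :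
  m = \sum_(b : {ffun 'I_n -> 'I_r.+1}) act (xi F n r (fun a => b a)) m.
Proof.
have [_ _ _ H1] := Hact.
rewrite -[LHS]H1 (@smod_lc _ (fun _ => 1) (fun b : {ffun 'I_n -> 'I_r.+1} =>
    xi F n r (fun a => b a))).
- by apply: eq_bigr => b _; rewrite scale1r.
- by move=> b; apply: in_schur_xi.
move=> [i j]; have lt a : (wt i a < r.+1)%N.
  by rewrite ltnS /wt (leq_trans (max_card _)) // card_ord.
rewrite (bigD1 [ffun a => Ordinal (lt a)]) //= !ffunE /= mul1r.
have -> : [forall a, wt i a == [ffun a => Ordinal (lt a)] a].
  by apply/forallP => a; rewrite ffunE.
rewrite andbT big1 ?addr0 // => b nb; rewrite mul1r ffunE /= (_ : _ && _ = false) //.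
apply: contraNF nb => /andP[_ /forallP H]; apply/eqP/ffunP => a; apply: val_inj.
by rewrite ffunE /=; apply/esym/eqP.
Qed.

(** The basis tensors of a given weight form one orbit under place permutations, with which [A] and
    [B] commute, so column [J] determines the others. *)
Lemma smod_xw_ext A B J m : in_schur F A -> in_schur F B ->
  (forall i, A (i, J) = B (i, J)) -> act A (act (xw F J) m) = act B (act (xw F J) m).
Proof.
move=> sA sB AB; rewrite !smod_mul //; try exact: in_schur_xi.
congr (act _ _); apply/ffunP => -[i j]; rewrite !emul_xir.
case: eq_wtP => [[p ->]|]; last by rewrite !mulr0.
have -> : i = pplace (pplace i p^-1%g) p.
  by apply/ffunP => k; rewrite !ffunE permK.
by rewrite sA sB AB.
Qed.

Lemma smod_xw_eq0 A J m : in_schur F A ->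
  (forall i, A (i, J) = 0) -> act A (act (xw F J) m) = 0.
Proof.
move=> sA A0; rewrite smod_mul //; last exact: in_schur_xi.
rewrite smod0 // => -[i j].
rewrite emul_xir; case: eq_wtP => [[p ->]|]; last by rewrite mulr0.
have -> : i = pplace (pplace i p^-1%g) p.
  by apply/ffunP => k; rewrite !ffunE permK.
by rewrite sA A0 mul0r.
Qed.

Lemma smod_xi_eq0 a m : (forall J, ~~ [forall b, wt J b == a b]) ->
  act (xi F n r a) m = 0.
Proof.
by move=> H; rewrite smod0 // => -[i j]; rewrite ffunE (negPf (H _)) andbF.
Qed.

End SchurModule.

(** * Weight idempotents as combinations of diagonal matrices *)

Section Interpolation.
Variables (F : fieldType) (HF : infinite_field F).

Lemma infinite_nodes N : exists l : seq F, [/\ uniq l, size l = N & 0 \notin l].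
Proof.
elim: N => [|N [l [ul <- l0]]]; first by exists [::].
have [x] := HF (0 :: l); rewrite inE negb_or => /andP[x0 xl].
by exists (x :: l); rewrite /= xl ul inE negb_or eq_sym x0.
Qed.

(** The [c] solve a Vandermonde system at distinct nonzero nodes [lam]; the functional reads off the
    coefficient of degree [K]. *)
Lemma power_functional N K : exists lam c : 'I_N -> F,
  (forall l, lam l != 0) /\
  forall k, (k < N)%N -> \sum_l c l * lam l ^+ k = (k == K)%:R.
Proof.
have [s [us ss s0]] := infinite_nodes N.
pose a : 'rV[F]_N := \row_j s`_j.
have Vu : Vandermonde N a \in unitmx.
  rewrite unitmxE det_Vandermonde unitfE prodf_seq_neq0; apply/allP => i _ /=.
  rewrite prodf_seq_neq0; apply/allP => j _; apply/implyP => ij.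
  rewrite !mxE subr_eq0 nth_uniq ?ss ?ltn_ord //.
  by rewrite neq_ltn ij orbT.
pose e : 'cV[F]_N := \col_k (val k == K)%:R.
exists (fun l => s`_l), (fun l => (invmx (Vandermonde N a) *m e) l 0); split.
  by move=> l; apply: contraNneq s0 => <-; rewrite mem_nth // ss.
move=> k kN; have := mulKVmx Vu e => /matrixP /(_ (Ordinal kN) 0).
rewrite !mxE => <-; apply: eq_bigr => l _.
by rewrite mulrC; congr (_ * _); rewrite !mxE.
Qed.

(** The lowest digit is the residue modulo [N]; cancelling it and dividing by [N] leaves the
    induction hypothesis. *)
Lemma digits_inj n N (f g : nat -> nat) :
  (forall a, f a < N)%N -> (forall a, g a < N)%N ->
  (\sum_(a < n) f a * N ^ a = \sum_(a < n) g a * N ^ a)%N ->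
  forall a, (a < n)%N -> f a = g a.
Proof.
elim: n f g => // n IH f g fN gN; rewrite !big_ord_recl !expn0 !muln1.
have S (h : nat -> nat) : (\sum_(i < n) h (lift ord0 i) * N ^ lift ord0 i =
    N * \sum_(i < n) h i.+1 * N ^ i)%N.
  by rewrite big_distrr; apply: eq_bigr => i _; rewrite expnS mulnCA.
rewrite (S f) (S g) => E.
have E0 : f 0 = g 0.
  have m x y : (x < N -> (x + N * y) %% N = x)%N.
    by move=> xN; rewrite addnC mulnC modnMDl modn_small.
  by have := congr1 (modn^~ N) E; rewrite /= !m.
move: E => /=; rewrite E0 => /addnI/eqP.
rewrite eqn_pmul2l ?(leq_ltn_trans _ (fN 0)) // => /eqP E [_|a an]; first by [].
by apply: (IH (fun a => f a.+1) (fun a => g a.+1)).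
Qed.

Variables n r : nat.

(** The exponent of [x] with which [tdiag N x] scales the basis tensor [i]. *)
Definition wt_code N (i : tidx n r) : nat := (\sum_(k < r) N ^ i k)%N.

Lemma wt_codeP (i j : tidx n r) :
  (wt_code r.+1 i == wt_code r.+1 j) = [forall a, wt i a == wt j a].
Proof.
have D (l : tidx n r) : wt_code r.+1 l = (\sum_(a < n) wt l a * r.+1 ^ a)%N.
  rewrite /wt_code (partition_big l xpredT) //=; apply: eq_bigr => a _.
  rewrite (eq_bigr (fun=> r.+1 ^ a)%N) => [|k /eqP -> //].
  by rewrite sum_nat_const /wt cardsE.
apply/eqP/forallP => [|H]; last by rewrite !D; apply: eq_bigr => a _; rewrite (eqP (H a)).
rewrite !D.
(* [digits_inj] takes functions on all of [nat], so multiplicities are extended by zero. *)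
pose w (l : tidx n r) (x : nat) := if (insub x : option 'I_n) is Some a then wt l a else 0%N.
have wE l (a : 'I_n) : w l a = wt l a by rewrite /w valK.
have wN l x : (w l x < r.+1)%N.
  rewrite /w; case: insub => // a.
  by rewrite ltnS /wt (leq_trans (max_card _)) // card_ord.
under eq_bigr do rewrite -wE; under [RHS]eq_bigr do rewrite -wE.
by move=> /(digits_inj (wN i) (wN j)) E a; rewrite -!wE E.
Qed.

Definition tdiag N (x : F) : 'M[F]_n := diag_mx (\row_a x ^+ (N ^ a)).

Lemma er_tdiag N x (i j : tidx n r) :
  er F n r (tdiag N x) (i, j) = (i == j)%:R * x ^+ wt_code N i.
Proof.
rewrite ffunE /=; case: eqVneq => [->|ne].
  rewrite mul1r /wt_code expr_sum; apply: eq_bigr => k _.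
  by rewrite !mxE eqxx.
have [k Hk] : exists k, i k != j k.
  apply/existsP; apply: contraR ne => /existsPn H; apply/eqP/ffunP => k.
  by apply/eqP; rewrite -[_ == _]negbK.
by rewrite mul0r (bigD1 k) //= !mxE (negPf Hk) mul0r.
Qed.

Lemma tdiag_unit N x : x != 0 -> tdiag N x \in unitmx.
Proof.
move=> x0; rewrite unitmxE det_diag unitfE prodf_seq_neq0.
by apply/allP => i _ /=; rewrite mxE expf_neq0.
Qed.

(* The code is an integer encoding of the weight in base r + 1, so that a
   linear combination of the one-parameter family [tdiag] isolates one weight. *)
Lemma xw_tdiag (J : tidx n r) : exists N (lam c : 'I_N -> F),
  (forall l, lam l != 0) /\
  forall ij, xw F J ij = \sum_l c l * er F n r (tdiag r.+1 (lam l)) ij.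
Proof.
pose N := (\max_(i : tidx n r) wt_code r.+1 i).+1.
have [lam [c [lam0 Hc]]] := power_functional N (wt_code r.+1 J).
exists N, lam, c; split=> // -[i j]; rewrite xwE.
under eq_bigr do rewrite er_tdiag mulrCA.
rewrite -mulr_sumr Hc; last by rewrite ltnS (leq_bigmax i).
by rewrite wt_codeP -natrM mulnb.
Qed.

End Interpolation.

(** * Matrices of partial maps between basis vectors *)

Section PartialMaps.
Variables (F : fieldType) (n : nat).
Implicit Types f : nat -> option nat.

(* v_b is sent to v_{f b}, or to 0 where f is undefined *)
Definition pm f : 'M[F]_n := \matrix_(a, b) (f b == Some (val a))%:R.

Lemma eq_pm f f' : (forall b, (b < n)%N -> f b = f' b) -> pm f = pm f'.
Proof. by move=> E; apply/matrixP => a b; rewrite !mxE E. Qed.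

Lemma pm1 : pm Some = 1%:M.
Proof. by apply/matrixP => a b; rewrite !mxE eq_sym. Qed.

(** The range condition matters: a value [c >= n] has no basis vector, yet [f] could send it back
    into range. *)
Lemma pm_mul f f' : (forall b c, (b < n)%N -> f' b = Some c -> (c < n)%N) ->
  pm f *m pm f' = pm (fun b => obind f (f' b)).
Proof.
move=> f'n; apply/matrixP => a b; rewrite !mxE.
case E: (f' b) => [c|] /=; last first.
  by rewrite big1 // => k _; rewrite !mxE E mulr0.
have cn := f'n _ _ (ltn_ord b) E.
rewrite (bigD1 (Ordinal cn)) //= !mxE E eqxx mulr1 big1 ?addr0 // => k kc.
rewrite !mxE E (_ : Some c == Some (val k) = false) ?mulr0 //.
by apply: contraNF kc => /eqP[ck]; apply/eqP/val_inj.
Qed.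

Lemma er_pm r f (i j : tidx n r) :
  er F n r (pm f) (i, j) = [forall k, f (j k) == Some (val (i k))]%:R.
Proof.
rewrite ffunE /=; case: (boolP [forall k, _]) => [/forallP H|/forallPn[k /negPf H]].
  by rewrite big1 // => k _; rewrite mxE H.
by rewrite (bigD1 k) //= mxE H mul0r.
Qed.

End PartialMaps.

(** * Partial maps and diagonal matrices acting on weight vectors *)

Section PartialMapAction.
Variables (F : fieldType) (n r : nat) (M : lmodType F) (act : endo F n r -> M -> M).
Hypothesis Hact : is_smod F n r act.
Implicit Types (f : nat -> option nat) (J : tidx n r) (m : M).

(** Column [J] of the diagonal action of [pm F n f] is supported in row [J'] alone. *)
Lemma act_pm_wt f J J' m : (forall k, f (J k) = Some (val (J' k))) ->
  act (xw F J') (act (er F n r (pm F n f)) (act (xw F J) m)) =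
  act (er F n r (pm F n f)) (act (xw F J) m).
Proof.
move=> fJ; have sE := @in_schur_er F n r; have sX := @in_schur_xi F n r (wt J').
rewrite [LHS](smod_mul Hact) //; apply: (smod_xw_ext Hact) => //.
  exact: in_schur_emul.

move=> i; rewrite /xw emul_xil er_pm; case: (boolP [forall k, f (J k) == _]) => [/forallP H|_]; last by rewrite mulr0.
have -> : i = J'.
  by apply/ffunP => k; have := H k; rewrite fJ => /eqP[/val_inj].
by rewrite mulr1 (_ : [forall b, _]) //; apply/forallP.
Qed.

Lemma act_pm_eq f f' J m : (forall k, f (J k) = f' (J k)) ->
  act (er F n r (pm F n f)) (act (xw F J) m) = act (er F n r (pm F n f')) (act (xw F J) m).
Proof.
move=> E; apply: (smod_xw_ext Hact); try exact: in_schur_er.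
by move=> i; rewrite !er_pm; under eq_forallb do rewrite E.
Qed.

Lemma act_pm_id f J m : (forall k, f (J k) = Some (val (J k))) ->
  act (er F n r (pm F n f)) (act (xw F J) m) = act (xw F J) m.
Proof. by move=> E; rewrite (act_pm_eq (f' := Some)) // pm1 (smod_er1 Hact). Qed.

Lemma xw_pplace J p : xw F (pplace J p) = xw F J.
Proof.
apply/ffunP => -[i j]; rewrite !xwE.
by under eq_forallb do rewrite wt_pplace.
Qed.

Lemma act_xw_idem J m : act (xw F J) (act (xw F J) m) = act (xw F J) m.
Proof. by have := @act_pm_wt Some J J m; rewrite pm1 !(smod_er1 Hact); apply. Qed.

Lemma act_pm_eq0 f J k m : f (J k) = None ->
  act (er F n r (pm F n f)) (act (xw F J) m) = 0.
Proof.
move=> E; apply: (smod_xw_eq0 Hact); first exact: in_schur_er.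
by move=> i; rewrite er_pm; case: forallP => // /(_ k); rewrite E.
Qed.

Lemma act_tdiag N x J m : act (er F n r (tdiag n N x)) (act (xw F J) m) =
  x ^+ wt_code N J *: act (xw F J) m.
Proof.
(* The scalar as an element of the algebra, to be compared with the diagonal matrix on column
   [J]. *)
pose B : endo F n r := [ffun ij => x ^+ wt_code N J * eone F n r ij].
have Bm y : act B y = x ^+ wt_code N J *: y.
  have [_ _ _ H1] := Hact; rewrite -{2}[y]H1.
  rewrite (@smod_lc _ _ _ _ _ Hact unit (fun _ => x ^+ wt_code N J) (fun _ => eone F n r)).
  - by rewrite (big_pred1 tt) // => -[].
  - by move=> _; rewrite -er1; apply: in_schur_er.
  by move=> ij; rewrite (big_pred1 tt) ?ffunE // => -[].
rewrite -Bm; apply: (smod_xw_ext Hact); first exact: in_schur_er.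
  by move=> p i j; rewrite !ffunE /= (inj_eq (@pplace_inj _ _ p)).
move=> i; rewrite er_tdiag !ffunE /= mulrC.
by case: eqVneq => [->|]; rewrite ?mulr0.
Qed.

End PartialMapAction.

(** * The weight omega_r *)

Section Omega.
Variables (F : fieldType) (n r : nat).
Hypothesis rn : (r <= n)%N.

Definition first_idx : tidx n r := [ffun k => widen_ord rn k].

Lemma first_idxE k : val (first_idx k) = k.
Proof. by rewrite ffunE. Qed.

Lemma xi_omega : xi F n r (omega n r) = xw F first_idx.
Proof.
apply/ffunP => -[i j]; rewrite !ffunE /=; congr ((_ && _ : bool)%:R).
apply: eq_forallb => a; congr (_ == _); rewrite /omega /wt.
case: (ltnP a r) => ar.
  rewrite (_ : [set _ | _] = [set Ordinal ar]) ?cards1 //.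
  by apply/setP => k; rewrite !inE -val_eqE first_idxE.
rewrite (_ : [set _ | _] = set0) ?cards0 //.
apply/setP => k; rewrite !inE -val_eqE first_idxE /=; apply/eqP => ka.
by have := ltn_ord k; rewrite ka ltnNge ar.
Qed.

End Omega.

(** * Blocks of size r and the wreath product *)

Section Blocks.
Variables r s : nat.
Implicit Types (q : 'I_s) (j : 'I_r) (x : 'I_(r * s)).

Lemma enc_subproof q j : (q * r + j < r * s)%N.
Proof. by have := ltn_ord q; have := ltn_ord j; nia. Qed.

Definition enc q j : 'I_(r * s) := Ordinal (enc_subproof q j).

Lemma blk_size_gt0 x : (0 < r)%N.
Proof. by have := ltn_ord x; case: (posnP r) => // r0; nia. Qed.

Lemma blk_subproof x : (x %/ r < s)%N.
Proof. by rewrite ltn_divLR ?(blk_size_gt0 x) // (leq_trans (ltn_ord x)) // mulnC. Qed.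

Definition blk x : 'I_s := Ordinal (blk_subproof x).

Lemma pos_subproof x : (x %% r < r)%N.
Proof. by rewrite ltn_mod (blk_size_gt0 x). Qed.

Definition pos x : 'I_r := Ordinal (pos_subproof x).

Lemma enc_div q j : ((q * r + j) %/ r = q)%N.
Proof.
have jr := ltn_ord j; have r0 : (0 < r)%N by apply: leq_trans jr.
by rewrite divnMDl // divn_small // addn0.
Qed.

Lemma enc_mod q j : ((q * r + j) %% r = j)%N.
Proof. by rewrite modnMDl modn_small. Qed.

Lemma encK x : enc (blk x) (pos x) = x.
Proof. by apply: val_inj; rewrite /= -divn_eq. Qed.

Lemma blk_enc q j : blk (enc q j) = q.
Proof. by apply: val_inj; rewrite /= enc_div. Qed.

Lemma pos_enc q j : pos (enc q j) = j.
Proof. by apply: val_inj; rewrite /= enc_mod. Qed.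

Lemma sum_enc (G : 'I_(r * s) -> nat) :
  (\sum_x G x = \sum_q \sum_j G (enc q j))%N.
Proof.
rewrite pair_big /= (reindex (fun p : 'I_s * 'I_r => enc p.1 p.2)) //.
exists (fun x => (blk x, pos x)) => [[q j] _|x _] /=; last exact: encK.
by rewrite blk_enc pos_enc.
Qed.

Lemma is_wrP (h : 'S_(r * s)) (sigma : {ffun 'I_s -> 'S_r}) (tau : 'S_s) :
  is_wr h sigma tau <-> forall q j, h (enc q j) = enc (tau q) (sigma (tau q) j).
Proof.
have E q j : wr_val sigma tau (enc q j) = enc (tau q) (sigma (tau q) j).
  by rewrite /wr_val /= enc_div enc_mod !valK.
split=> H; first by move=> q j; apply: val_inj; rewrite H E.
by move=> x; rewrite -(encK x) H E.
Qed.

Lemma wr_exists (h : 'S_(r * s)) (tau : 'S_s) :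
  (forall x, blk (h x) = tau (blk x)) -> exists sigma, is_wr h sigma tau.
Proof.
(* [sigma] is indexed by target blocks, hence the inverse of [tau]. *)
move=> H; pose f i j := pos (h (enc (tau^-1%g i) j)).
have fI i : injective (f i).
  move=> j j' E; suff /perm_inj E' : h (enc (tau^-1%g i) j) = h (enc (tau^-1%g i) j').
    by rewrite -(pos_enc (tau^-1%g i) j) E' pos_enc.
  by rewrite -[LHS]encK -[RHS]encK !H !blk_enc [pos _]E.
exists [ffun i => perm (fI i)]; apply/is_wrP => q j.
by rewrite ffunE permE /f permK -[LHS]encK H blk_enc.
Qed.

End Blocks.

(** * Permutation matrices *)

Section PermutationMatrices.
Variables (F : fieldType) (n k : nat).

Lemma papp_val (p : 'S_k) (x : 'I_k) : papp p x = p x.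
Proof. by rewrite /papp valK. Qed.

Lemma papp_out (p : 'S_k) (x : nat) : (k <= x)%N -> papp p x = x.
Proof. by move=> kx; rewrite /papp insubF // ltnNge kx. Qed.

Lemma papp_pc (p p' : 'S_k) (x : nat) : papp (pc p p') x = papp p (papp p' x).
Proof.
case: (ltnP x k) => xk; last by rewrite !papp_out.
by rewrite -[x]/(val (Ordinal xk)) !papp_val permM.
Qed.

Lemma papp1 (x : nat) : papp (1%g : 'S_k) x = x.
Proof.
case: (ltnP x k) => xk; last by rewrite papp_out.
by rewrite -[x]/(val (Ordinal xk)) papp_val perm1.
Qed.

Hypothesis kn : (k <= n)%N.

Lemma papp_lt (p : 'S_k) x : (x < n)%N -> (papp p x < n)%N.
Proof.
case: (ltnP x k) => xk xn; last by rewrite papp_out.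
by rewrite -[x]/(val (Ordinal xk)) papp_val (leq_trans (ltn_ord _)).
Qed.

Lemma pmxE (p : 'S_k) : pmx F n k p = pm F n (fun x => Some (papp p x)).
Proof. by apply/matrixP => a b; rewrite !mxE eq_sym. Qed.

Lemma pm_pmx f (p : 'S_k) : pm F n f *m pmx F n k p = pm F n (fun x => f (papp p x)).
Proof.
rewrite pmxE pm_mul // => b c bn [<-]; exact: papp_lt.
Qed.

Lemma pmx_pc (p p' : 'S_k) : pmx F n k (pc p p') = pmx F n k p *m pmx F n k p'.
Proof. by rewrite [pmx F n k p]pmxE pm_pmx pmxE; apply: eq_pm => b _; rewrite papp_pc. Qed.

Lemma pmx1 : pmx F n k 1%g = 1%:M.
Proof. by rewrite pmxE -pm1; apply: eq_pm => b _; rewrite papp1. Qed.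

Lemma pmx_unit (p : 'S_k) : pmx F n k p \in unitmx.
Proof.
have /mulmx1_unit[] // : pmx F n k p *m pmx F n k p^-1%g = 1%:M.
by rewrite -pmx_pc /pc mulVg pmx1.
Qed.

End PermutationMatrices.

(** * Zero factors and scaled factors *)

Section MultilinearScaling.
Variables (F : fieldType) (s : nat) (M T : lmodType F).
Variable h : {ffun 'I_s -> M} -> T.
Implicit Type m : {ffun 'I_s -> M}.

Lemma multilin_eq0 P m i : multilin F P h -> P 0 -> (forall j, P (m j)) -> m i = 0 ->
  h m = 0.
Proof.
move=> mh P0 Pm mi; have := mh m i (-1) 0 0 Pm P0 P0.
by rewrite scaler0 addr0 -mi upd_id scaleN1r addNr.
Qed.

Lemma multilin_scale (a : 'I_s -> F) m : multilin F (fun _ => True) h ->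
  h [ffun i => a i *: m i] = (\prod_i a i) *: h m.
Proof.
(* Generalised to scaling only the slots in a list [e]; as [e] has no repetition, its head is
   unscaled by the tail. *)
move=> mh; set e := index_enum _.
transitivity (h [ffun i => (if i \in e then a i else 1) *: m i]).
  by congr h; apply/ffunP => i; rewrite !ffunE mem_index_enum.
elim: e (index_enum_uniq 'I_s : uniq e) => [_|i l IH /= /andP[il ul]].
  by rewrite big_nil scale1r; congr h; apply/ffunP => i; rewrite !ffunE scale1r.
rewrite big_cons -scalerA -IH //.
set m' := [ffun j => (if j \in l then a j else 1) *: m j].
have Em : m' i = m i by rewrite ffunE (negPf il) scale1r.
rewrite -[in RHS](upd_id m' i) Em -(islinZ _ _ (multilin_slot m' i mh)).
congr h; apply/ffunP => j; rewrite !ffunE inE.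
by case: eqVneq => [->|].
Qed.

End MultilinearScaling.

(** * The tensor power and the induced module *)

Section InducedModule.
Variables (F : fieldType) (n r s : nat).
Hypotheses (HF : infinite_field F) (r_gt0 : (0 < r)%N) (rn : (r <= n)%N) (rsn : (r * s <= n)%N).
Variables (M : lmodType F) (act : endo F n r -> M -> M).
Hypothesis Hact : is_smod F n r act.
Variables (T : lmodType F) (t : {ffun 'I_s -> M} -> T).
Hypothesis Ht : is_tensor_power F (fun _ : M => True) t.
Variable actT : endo F n (r * s) -> T -> T.
Hypothesis HactT : is_smod F n (r * s) actT.
Hypothesis HactTg : forall g : 'M[F]_n, g \in unitmx -> forall m : {ffun 'I_s -> M},
  actT (er F n (r * s) g) (t m) = t [ffun i => act (er F n r g) (m i)].
Variable rp : 'S_s -> T -> T.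
Hypothesis Hrp_lin : forall tau, islin F (rp tau).
Hypothesis Hrp : forall (tau : 'S_s) (m : {ffun 'I_s -> M}),
  rp tau (t m) = t [ffun i => m (tau i)].
Variables (T2 : lmodType F) (t2 : {ffun 'I_s -> M} -> T2).
Hypothesis Ht2 : is_tensor_power F (fimg F n r act) t2.
Variable wact : {ffun 'I_s -> 'S_r} -> 'S_s -> T2 -> T2.
Hypothesis Hwact_lin : forall sigma tau, islin F (wact sigma tau).
Hypothesis Hwact :
  forall (sigma : {ffun 'I_s -> 'S_r}) (tau : 'S_s) (m : {ffun 'I_s -> M}),
  (forall j, fimg F n r act (m j)) ->
  wact sigma tau (t2 m)
  = t2 [ffun i => act (er F n r (pmx F n r (sigma i))) (m ((tau^-1)%g i))].

Implicit Types (m : {ffun 'I_s -> M}) (g h : 'S_(r * s)) (k tau : 'S_s).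

Local Notation iota := (first_idx rn).
Local Notation iotaT := (first_idx rsn).
Local Notation E A := (er F n r A).
Local Notation ET A := (er F n (r * s) A).
Local Notation P := (pmx F n (r * s)).
Local Notation X := (act (xw F iota)).
Local Notation XT := (actT (xw F iotaT)).

Lemma actE_lin A : islin F (act (E A)).
Proof. exact/(smod_lin Hact)/in_schur_er. Qed.

Lemma actTE_lin A : islin F (actT (ET A)).
Proof. exact/(smod_lin HactT)/in_schur_er. Qed.

Lemma actX_lin : islin F X.
Proof. exact/(smod_lin Hact)/in_schur_xi. Qed.

Lemma actXT_lin : islin F XT.
Proof. exact/(smod_lin HactT)/in_schur_xi. Qed.

Lemma fimgX (x : M) : fimg F n r act (X x).
Proof. by exists x; rewrite (xi_omega _ rn). Qed.

Lemma fimg_fix (x : M) : fimg F n r act x -> X x = x.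
Proof. by case=> y ->; rewrite (xi_omega _ rn) (act_xw_idem Hact). Qed.

Lemma fimgT_fix (y : T) : fimg F n (r * s) actT y <-> XT y = y.
Proof.
split; last by move=> <-; exists y; rewrite (xi_omega _ rsn).
by case=> z ->; rewrite (xi_omega _ rsn) (act_xw_idem HactT).
Qed.

Lemma rp_er (A : 'M[F]_n) k y : A \in unitmx ->
  rp k (actT (ET A) y) = actT (ET A) (rp k y).
Proof.
move=> uA; apply: (tensor_ext (f := rp k \o actT (ET A)) (g := actT (ET A) \o rp k) Ht).
- exact: islin_comp (Hrp_lin k) (actTE_lin A).
- exact: islin_comp (actTE_lin A) (Hrp_lin k).
move=> m _ /=; rewrite HactTg // !Hrp HactTg //.
by congr t; apply/ffunP => i; rewrite !ffunE.
Qed.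

Lemma rp_pc k k' y : rp k' (rp k y) = rp (pc k k') y.
Proof.
apply: (tensor_ext (f := rp k' \o rp k) (g := rp (pc k k')) Ht).
- exact: islin_comp.
- exact: Hrp_lin.
move=> m _ /=; rewrite !Hrp.
by congr t; apply/ffunP => i; rewrite !ffunE permM.
Qed.

(** The idempotent is a combination of invertible diagonal matrices, which commute with place
    permutations by [rp_er]. *)
Lemma rp_XT k y : rp k (XT y) = XT (rp k y).
Proof.
have [N [lam [c [lam0 Hc]]]] := xw_tdiag HF iotaT.
have sd l : in_schur F (ET (tdiag n (r * s).+1 (lam l))) by apply: in_schur_er.
rewrite !(smod_lc HactT _ sd Hc) (islin_sum _ _ _ (Hrp_lin k)).
apply: eq_bigr => l _.
by rewrite (islinZ _ _ (Hrp_lin k)) rp_er //; apply: tdiag_unit.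
Qed.

Definition sub_idx (I : tidx n (r * s)) (q : 'I_s) : tidx n r := [ffun j => I (enc q j)].

(** Diagonal matrices scale each factor, and the exponents add up to the code of [I]; their
    combination thus gives the diagonal entry at [I]. *)
Lemma XT_tensor (I : tidx n (r * s)) m :
  (forall q, act (xw F (sub_idx I q)) (m q) = m q) ->
  XT (t m) = xw F iotaT (I, I) *: t m.
Proof.
move=> mI; have [N [lam [c [lam0 Hc]]]] := xw_tdiag HF iotaT.
have sd l : in_schur F (ET (tdiag n (r * s).+1 (lam l))) by apply: in_schur_er.
rewrite (smod_lc HactT _ sd Hc) Hc scaler_suml; apply: eq_bigr => l _.
rewrite HactTg ?tdiag_unit // -scalerA; congr (_ *: _).
rewrite er_tdiag eqxx mul1r.
transitivity (t [ffun q => lam l ^+ wt_code (r * s).+1 (sub_idx I q) *: m q]).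
  by congr t; apply/ffunP => q; rewrite !ffunE -mI (act_tdiag Hact).
rewrite (multilin_scale (fun q => lam l ^+ wt_code (r * s).+1 (sub_idx I q)) _ Ht.1).
congr (_ *: _); rewrite /wt_code sum_enc expr_sum.
by apply: eq_bigr => q _; congr (_ ^+ _); apply: eq_bigr => j _; rewrite ffunE.
Qed.

Definition blk_in (q : 'I_s) : nat -> option nat :=
  fun j => if (j < r)%N then Some (q * r + j)%N else None.
Definition blk_out (q : 'I_s) : nat -> option nat :=
  fun x => if (x %/ r == q)%N then Some (x %% r)%N else None.

(** Both maps are supplied later by the universal properties; [X] in [piE] brings the factors into
    f_r M, as [t2] requires. *)
Variables (theta : T2 -> T) (pi : T -> T2).
Hypothesis theta_lin : islin F theta.
Hypothesis thetaE : forall m, (forall j, fimg F n r act (m j)) ->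
  theta (t2 m) = t [ffun q => act (E (pm F n (blk_in q))) (m q)].
Hypothesis pi_lin : islin F pi.
Hypothesis piE : forall m,
  pi (t m) = t2 [ffun q => X (act (E (pm F n (blk_out q))) (m q))].

Definition gblk g (q : 'I_s) : nat -> option nat :=
  fun j => if (j < r)%N then Some (papp g (q * r + j)) else None.

Lemma gblk_iota g q j : gblk g q (iota j) = Some (val (g (enc q j))).
Proof.
rewrite /gblk first_idxE ltn_ord; congr Some.
exact: (papp_val g (enc q j)).
Qed.

Lemma pm_blk_in g q : P g *m pm F n (blk_in q) = pm F n (gblk g q).
Proof.
rewrite pmxE // pm_mul => [|b c bn]; last first.
  rewrite /blk_in; case: ltnP => // br [<-].
  exact: leq_trans (enc_subproof q (Ordinal br)) rsn.
by apply: eq_pm => b bn; rewrite /blk_in /gblk; case: ifP.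
Qed.

(** * The map [Phi]: balancing and image weight *)

Definition summand (p : 'S_(r * s) * 'S_s) (y : T2) : T :=
  rp p.2 (actT (ET (P p.1)) (theta y)).

Lemma summand_lin p : islin F (summand p).
Proof.
apply: (islin_comp (Hrp_lin p.2)); apply: islin_comp => //; exact: actTE_lin.
Qed.

Lemma summandE g k m : (forall j, fimg F n r act (m j)) ->
  summand (g, k) (t2 m) = t [ffun q => act (E (pm F n (gblk g (k q)))) (m (k q))].
Proof.
move=> fm; rewrite /summand /= thetaE // HactTg ?pmx_unit // Hrp.
by congr t; apply/ffunP => q; rewrite !ffunE (smod_er Hact) pm_blk_in.
Qed.

Definition Phi (u : {ffun 'S_(r * s) * 'S_s -> T2}) : T := \sum_p summand p (u p).

Lemma Phi_lin : islin F Phi.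
Proof.
move=> a x y; rewrite /Phi scaler_sumr -big_split /=.
by apply: eq_bigr => p _; rewrite !ffunE summand_lin.
Qed.

Lemma Phi_single g k y : Phi (single F g k y) = summand (g, k) y.
Proof.
rewrite /Phi (bigD1 (g, k)) //= ffunE eqxx big1 ?addr0 // => p pk.
by rewrite ffunE (negPf pk) (islin0 (summand_lin p)).
Qed.

(** On pure tensors the [q]-th factors both come from [m (k q)], and [h] carries block [k q] to
    block [tau (k q)] through [sigma (tau (k q))]. *)
Lemma summand_rel g h sigma tau k y : is_wr h sigma tau ->
  summand (pc g h, k) y = summand (g, pc tau k) (wact sigma tau y).
Proof.
move=> /is_wrP hw.
apply: (tensor_ext (f := summand (pc g h, k))
  (g := summand (g, pc tau k) \o wact sigma tau) Ht2).
- exact: summand_lin.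
- exact: islin_comp (summand_lin _) (Hwact_lin _ _).
move=> m fm /=; rewrite Hwact // !summandE //; last first.
  move=> j; rewrite ffunE pmxE // -(fimg_fix (fm _)).
  rewrite -(act_pm_wt Hact (J' := pplace iota (sigma j))).
    by rewrite xw_pplace; apply: fimgX.
  by move=> i; rewrite first_idxE papp_val !ffunE.
congr t; apply/ffunP => q; rewrite !ffunE permM permK (smod_er Hact) pm_pmx //.
rewrite -(fimg_fix (fm _)); apply: (act_pm_eq Hact) => j.
rewrite gblk_iota first_idxE papp_val.
have := gblk_iota g (tau (k q)) (sigma (tau (k q)) j); rewrite first_idxE => ->.
by rewrite permM hw.
Qed.

(** The blocks, read one after another, list the first rs basis vectors. *)
Lemma theta_XT y : XT (theta y) = theta y.
Proof.
apply: (tensor_ext (f := XT \o theta) (g := theta) Ht2) => //.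
  exact: islin_comp actXT_lin theta_lin.
move=> m fm /=; rewrite thetaE // (XT_tensor (I := iotaT)).
  rewrite xwE eqxx (_ : [forall a, _]) ?scale1r //.
  by apply/forallP.
move=> q; rewrite ffunE -(fimg_fix (fm q)) (act_pm_wt Hact) // => j.
by rewrite /blk_in !first_idxE ltn_ord ffunE first_idxE.
Qed.

Lemma Phi_XT u : XT (Phi u) = Phi u.
Proof.
rewrite /Phi (islin_sum _ _ _ actXT_lin); apply: eq_bigr => p _.
rewrite /summand -rp_XT -theta_XT pmxE //.
have := act_pm_wt HactT (f := fun x => Some (papp p.1 x)) (J := iotaT)
  (J' := pplace iotaT p.1) (theta (u p)).
rewrite xw_pplace => -> // x.
by rewrite first_idxE papp_val !ffunE.
Qed.

(* The colour of a point is the tensor factor in which it ends up; two summands of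
   the induced module are identified exactly when they have the same colouring. *)
Definition colouring (p : 'S_(r * s) * 'S_s) : {ffun 'I_(r * s) -> 'I_s} :=
  [ffun x => (p.2^-1)%g (blk ((p.1^-1)%g x))].

(** [choose] agrees on equivalent predicates, so the representative depends on the colouring
    only. *)
Definition canon p := choose (fun p' => colouring p' == colouring p) p.

Lemma colouring_canon p : colouring (canon p) = colouring p.
Proof. exact/eqP/(@chooseP _ (fun p' => colouring p' == colouring p) p). Qed.

Lemma canon_eq p p' : colouring p = colouring p' -> canon p = canon p'.
Proof.
move=> e; rewrite /canon.
rewrite (@eq_choose _ _ (fun q => colouring q == colouring p')); last by move=> q; rewrite e.
by apply: choose_id; rewrite ?e.
Qed.

Lemma colouring_wr p1 p : colouring p1 = colouring p ->
  exists sigma, is_wr (pc (p1.1^-1)%g p.1) sigma (pc p1.2 (p.2^-1)%g).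
Proof.
move=> e; apply: wr_exists => x.
(* Comparing the colours of [p.1 x] and applying [p1.2] shows that blocks go to blocks. *)
have := congr1 (fun f : {ffun _ -> _} => p1.2 (f (p.1 x))) e.
by rewrite /= !ffunE permKV permK !permM.
Qed.

(** * Recovering a summand from its image *)

Definition extract (p : 'S_(r * s) * 'S_s) (y : T) : T2 :=
  pi (actT (ET (P (p.1^-1)%g)) (rp (p.2^-1)%g y)).

Lemma extract_lin p : islin F (extract p).
Proof.
apply: (islin_comp pi_lin); apply: islin_comp (Hrp_lin _); exact: actTE_lin.
Qed.

(** Follows v_j from block [q'] through [g] back out of block [q]; undefined if it lands in another
    block. *)
Definition transition g q q' : nat -> option nat :=
  fun j => obind (blk_out q) (gblk g q' j).

Lemma gblk_lt g q j c : gblk g q j = Some c -> (c < n)%N.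
Proof.
rewrite /gblk; case: ltnP => // jr [<-]; apply: papp_lt => //.
exact: leq_trans (enc_subproof q (Ordinal jr)) rsn.
Qed.

Lemma pm_transition g q q' :
  pm F n (transition g q q') = pm F n (blk_out q) *m pm F n (gblk g q').
Proof. by rewrite pm_mul // => b c _; apply: gblk_lt. Qed.

Lemma extract_summand p1 p m : (forall j, fimg F n r act (m j)) ->
  extract p1 (summand p (t2 m)) =
  t2 [ffun q => X (act (E (pm F n (transition (pc (p1.1^-1)%g p.1) q
                                      (pc p.2 (p1.2^-1)%g q))))
                       (m (pc p.2 (p1.2^-1)%g q)))].
Proof.
case: p p1 => [g k] [g1 k1] fm /=; rewrite /extract /= summandE // Hrp HactTg ?pmx_unit //.
rewrite piE; congr t2; apply/ffunP => q; rewrite !ffunE !(smod_er Hact) permM.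
by rewrite pm_transition -!pm_blk_in pmx_pc // !mulmxA.
Qed.

Lemma transition_iota g q q' j : transition g q q' (iota j) =
  if blk (g (enc q' j)) == q then Some (val (pos (g (enc q' j)))) else None.
Proof. by rewrite /transition gblk_iota. Qed.

Lemma extract_eq0 p1 p y : colouring p1 <> colouring p -> extract p1 (summand p y) = 0.
Proof.
move=> ne; apply: (tensor_ext (f := extract p1 \o summand p) (g := fun=> 0) Ht2).
- exact: islin_comp (extract_lin _) (summand_lin _).
- by move=> a x z; rewrite scaler0 addr0.
move=> m fm /=; rewrite extract_summand //.
have [x Hx] : exists x, colouring p1 x != colouring p x.
  apply/existsP; rewrite -negb_forall; apply/negP => /forallP H; apply: ne.
  by apply/ffunP => x; apply/eqP.
(* Factor [q] receives [x] from [p], but [p1] does not place [x] in its block [q], so this factor is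
   annihilated. *)
pose z := (p.1^-1)%g x; pose q := p1.2 ((p.2^-1)%g (blk z)).
apply: (multilin_eq0 (i := q) Ht2.1).
- by rewrite -(islin0 actX_lin); apply: fimgX.
- by move=> j; rewrite ffunE; apply: fimgX.
rewrite ffunE -(fimg_fix (fm _)) (act_pm_eq0 Hact (k := pos z)) ?(islin0 actX_lin) //.
rewrite transition_iota /q !permM permK permKV encK ifN //.
apply: contraNneq Hx; rewrite !ffunE {1}/z permKV => e.
by rewrite e permK.
Qed.

(** Whole blocks go to whole blocks, so each transition is defined on v_1, ..., v_r and permutes
    them by [sigma q]. *)
Lemma extract_wr p1 p sigma y : is_wr (pc (p1.1^-1)%g p.1) sigma (pc p1.2 (p.2^-1)%g) ->
  extract p1 (summand p y) = wact sigma (pc p1.2 (p.2^-1)%g) y.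
Proof.
move=> /is_wrP hw; set tau := pc p1.2 _ in hw *.
apply: (tensor_ext (f := extract p1 \o summand p) (g := wact sigma tau) Ht2) => //.
  exact: islin_comp (extract_lin _) (summand_lin _).
move=> m fm /=; rewrite extract_summand // Hwact //; congr t2; apply/ffunP => q.
have -> : pc p.2 (p1.2^-1)%g = (tau^-1)%g by rewrite /tau /pc invMg invgK.
rewrite !ffunE -[in LHS](fimg_fix (fm _)).
rewrite -[in RHS](fimg_fix (fm _)) pmxE.
rewrite (act_pm_eq Hact (f' := fun x => Some (papp (sigma q) x))).
  (* Permuting the places of [iota] keeps its weight, so the outer projection is absorbed. *)
  rewrite -[X in act X (act (E _) _)](xw_pplace F iota (sigma q)) (act_pm_wt Hact) //.
  by move=> j; rewrite first_idxE papp_val !ffunE.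
by move=> j; rewrite transition_iota hw permKV blk_enc pos_enc eqxx first_idxE papp_val.
Qed.

(** * The map [Psi] and the kernel of [Phi] *)

Definition Psi (y : T) : {ffun 'S_(r * s) * 'S_s -> T2} :=
  \sum_(p | canon p == p) single F p.1 p.2 (extract p y).

Lemma Psi_lin : islin F Psi.
Proof.
apply: islin_bigsum => p; apply: islin_comp (extract_lin p); exact: islin_single.
Qed.

Lemma Psi_summand p y : exists sigma,
  is_wr (pc ((canon p).1^-1)%g p.1) sigma (pc (canon p).2 (p.2^-1)%g) /\
  Psi (summand p y) =
  single F (canon p).1 (canon p).2 (wact sigma (pc (canon p).2 (p.2^-1)%g) y).
Proof.
have [sigma hw] := colouring_wr (colouring_canon p).
exists sigma; split=> //; rewrite /Psi (bigD1 (canon p)) /=; last first.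
  by apply/eqP/canon_eq/colouring_canon.
rewrite (extract_wr _ hw) big1 ?addr0 // => p1 /andP[/eqP c1 np].
rewrite extract_eq0 ?(islin0 (@islin_single _ _ _ _ _ _)) // => /canon_eq e.
by rewrite -c1 e eqxx in np.
Qed.

Definition balancing (z : {ffun 'S_(r * s) * 'S_s -> T2}) : Prop :=
  exists g h (sigma : {ffun 'I_s -> 'S_r}) tau k y, is_wr h sigma tau /\
  z = single F (pc g h) k y - single F g (pc tau k) (wact sigma tau y).

Lemma Phi_balancing z : balancing z -> Phi z = 0.
Proof.
move=> [g [h [sigma [tau [k [y [hw ->]]]]]]].
rewrite (islinD _ _ Phi_lin) -scaleN1r (islinZ _ _ Phi_lin) !Phi_single.
by rewrite (summand_rel _ _ _ hw) scaleN1r subrr.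
Qed.

(** Each summand differs from its copy at the representative by a single balancing relation. *)
Lemma PsiK_mod u : lspan F balancing (u - Psi (Phi u)).
Proof.
rewrite /Phi (islin_sum _ _ _ Psi_lin) {1}[u]ffun_sum_single -sumrB.
apply: lspan_sum => p _ W _ _; apply.
have [sigma [hw ->]] := Psi_summand p (u p).
exists (canon p).1, (pc ((canon p).1^-1)%g p.1), sigma, (pc (canon p).2 (p.2^-1)%g), p.2, (u p).
split=> //; congr (single _ _ _ _ - single _ _ _ _).
  by rewrite /pc mulgKV.
by rewrite /pc mulKVg.
Qed.

Lemma PhiPsiPhi u : Phi (Psi (Phi u)) = Phi u.
Proof.
have := lspan_ker Phi_lin Phi_balancing (PsiK_mod u).
rewrite (islinD _ _ Phi_lin) -scaleN1r (islinZ _ _ Phi_lin) scaleN1r.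
by move/eqP; rewrite subr_eq0 => /eqP.
Qed.

Lemma Phi_ker u : Phi u = 0 <-> lspan F balancing u.
Proof.
split; last by apply: lspan_ker Phi_balancing; apply: Phi_lin.
by move=> u0; have := PsiK_mod u; rewrite u0 (islin0 Psi_lin) subr0.
Qed.

(** * Surjectivity onto weight omega_{rs} *)

Lemma tensor_in_image (J : 'I_s -> tidx n r) m :
  (forall q, act (xw F (J q)) (m q) = m q) ->
  XT (t m) = 0 \/ exists u, t m = Phi u /\ XT (t m) = t m.
Proof.
move=> mJ; pose I : tidx n (r * s) := [ffun x => J (blk x) (pos x)].
have IJ q : sub_idx I q = J q.
  by apply/ffunP => j; rewrite !ffunE blk_enc pos_enc.
rewrite (XT_tensor (I := I)) => [|q]; last by rewrite IJ.
(* Either [I] rearranges the first rs indices, by some [g], or the coefficient is zero. *)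
rewrite xwE eqxx; case: eq_wtP => [[g Ig]|_]; last by left; rewrite scale0r.
right; rewrite scale1r.
have Jg q j : val (J q j) = g (enc q j).
  by rewrite -IJ ffunE Ig !ffunE.
pose out q := pm F n (fun x => blk_out q (papp (g^-1)%g x)).
(* Undoing [g] and leaving block [q] turns index [J q] into [iota]. *)
pose m' : {ffun 'I_s -> M} := [ffun q => X (act (E (out q)) (m q))].
exists (single F g 1%g (t2 m')); split=> //.
rewrite Phi_single summandE; last by move=> q; rewrite ffunE; apply: fimgX.
congr t; apply/ffunP => q; rewrite !ffunE perm1 -mJ /out.
rewrite (act_pm_wt Hact (J' := iota)) => [|j]; last first.
  by rewrite Jg papp_val permK /blk_out /= enc_div enc_mod eqxx first_idxE.
rewrite (smod_er Hact) pm_mul => [|b c _]; last first.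
  rewrite /blk_out; case: ifP => // _ [<-].
  by apply: leq_trans rn; rewrite ltn_mod.
rewrite (act_pm_id Hact) // => j.
rewrite -[nat_of_ord (J q j)]/(val (J q j)) Jg papp_val permK /blk_out /= enc_div enc_mod eqxx /=.
by rewrite /gblk ltn_ord (papp_val g (enc q j)).
Qed.

Lemma PhiPsiX y : Phi (Psi (XT y)) = XT y.
Proof.
have lin1 : islin F (Phi \o (Psi \o XT)).
  apply: islin_comp Phi_lin _; exact: islin_comp Psi_lin actXT_lin.
apply: (tensor_ext (f := Phi \o (Psi \o XT)) (g := XT) Ht) => // [|m _].
  exact: actXT_lin.
apply: (multilin_ext_decomp
  (e := fun (b : {ffun 'I_n -> 'I_r.+1}) => act (xi F n r (fun a => b a)))
  (h1 := (Phi \o (Psi \o XT)) \o t) (h2 := XT \o t)).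
- exact: multilin_comp Ht.1 lin1.
- exact: multilin_comp Ht.1 actXT_lin.
- exact: (smod_sum_xi Hact).
move=> {}m Hm /=.
(* A zero factor may carry a weight of no basis tensor; a nonzero one has weight [wt J] for some
   [J]. *)
case: (boolP [exists i, m i == 0]) => [/existsP[i /eqP mi]|/existsPn nz].
  rewrite (multilin_eq0 (i := i) Ht.1) //.
  by rewrite (islin0 actXT_lin) (islin0 Psi_lin) (islin0 Phi_lin).
have [J mJ] : exists J : 'I_s -> tidx n r, forall i, act (xw F (J i)) (m i) = m i.
  apply: (@fin_all_exists _ (fun=> tidx n r) (fun i J => act (xw F J) (m i) = m i)) => i.
  have [b [x mi]] := Hm i.
  case: (boolP [exists J : tidx n r, [forall a, wt J a == b a]]) => [|/existsPn nJ].
    move=> /existsP[J /forallP HJ]; exists J.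
    have xiE : xi F n r (fun a => b a) = xw F J.
      apply/ffunP => -[i' j']; rewrite !ffunE /=.
      by under eq_forallb do rewrite -(eqP (HJ _)).
    by rewrite mi xiE (act_xw_idem Hact).
  by have := nz i; rewrite mi (smod_xi_eq0 Hact) ?eqxx.
case: (tensor_in_image mJ) => [-> | [u [tu ->]]].
  by rewrite (islin0 Psi_lin) (islin0 Phi_lin).
by rewrite tu PhiPsiPhi.
Qed.

Lemma Phi_surj y : fimg F n (r * s) actT y -> exists u, Phi u = y.
Proof. by move=> /fimgT_fix yX; exists (Psi y); rewrite -yX PhiPsiX. Qed.

(** * Compatibility with the two actions *)

Lemma Phi_indl g u : Phi (indl F g u) = actT (ET (P g)) (Phi u).
Proof.
rewrite /Phi (islin_sum _ _ _ (actTE_lin _)).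
rewrite (reindex (fun p : 'S_(r * s) * 'S_s => (pc g p.1, p.2))) /=.
  apply: eq_bigr => p _; rewrite ffunE /= /summand /= -rp_er ?pmx_unit //.
  by rewrite (smod_er HactT) pmx_pc // /pc mulgK -surjective_pairing.
exists (fun p : 'S_(r * s) * 'S_s => (pc (g^-1)%g p.1, p.2)) => -[g' k] _ /=.
  by rewrite /pc mulgK.
by rewrite /pc mulgKV.
Qed.

Lemma Phi_indr tau u : Phi (indr F tau u) = rp tau (Phi u).
Proof.
rewrite /Phi (islin_sum _ _ _ (Hrp_lin _)).
rewrite (reindex (fun p : 'S_(r * s) * 'S_s => (p.1, pc p.2 tau))) /=.
  apply: eq_bigr => p _; rewrite ffunE /= /summand /= rp_pc.
  by rewrite /pc mulKg -surjective_pairing.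
exists (fun p : 'S_(r * s) * 'S_s => (p.1, pc p.2 (tau^-1)%g)) => -[g' k] _ /=.
  by rewrite /pc mulKg.
by rewrite /pc mulKVg.
Qed.

End InducedModule.

(** * Construction of [theta] and [pi], and the bimodule isomorphism *)

Unset Implicit Arguments.

Theorem theorem3p1 (F : fieldType) (HF : infinite_field F) (n r s : nat)
  (hr : (0 < r)%N) (hs : (0 < s)%N) (hn : (r * s <= n)%N)
  (* M : a left S(n,r)-module *)
  (M : lmodType F) (act : endo F n r -> M -> M) (Hact : is_smod F n r act)
  (* M^{⊗s} (universal s-multilinear map t) with its S(n,rs)-module structure,
     characterised by e_{rs}(g)(m_1 ⊗ ... ⊗ m_s) = e_r(g) m_1 ⊗ ... ⊗ e_r(g) m_s *)
  (T : lmodType F) (t : {ffun 'I_s -> M} -> T)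
  (Ht : is_tensor_power F (fun _ : M => True) t)
  (actT : endo F n (r * s) -> T -> T) (HactT : is_smod F n (r * s) actT)
  (HactTg : forall g : 'M[F]_n, g \in unitmx -> forall m : {ffun 'I_s -> M},
      actT (er F n (r * s) g) (t m) = t [ffun i => act (er F n r g) (m i)])
  (* right S_s-action on M^{⊗s} by place permutations *)
  (rp : 'S_s -> T -> T) (Hrp_lin : forall tau, islin F (rp tau))
  (Hrp : forall (tau : 'S_s) (m : {ffun 'I_s -> M}),
      rp tau (t m) = t [ffun i => m (tau i)])
  (* (f_r M)^{⊗s} (universal s-multilinear map t2 on f_r M) *)
  (T2 : lmodType F) (t2 : {ffun 'I_s -> M} -> T2)
  (Ht2 : is_tensor_power F (fimg F n r act) t2)
  (* its left action of (sigma_1,...,sigma_s) tau in S_r wr S_s *)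
  (wact : {ffun 'I_s -> 'S_r} -> 'S_s -> T2 -> T2)
  (Hwact_lin : forall sigma tau, islin F (wact sigma tau))
  (Hwact : forall (sigma : {ffun 'I_s -> 'S_r}) (tau : 'S_s) (m : {ffun 'I_s -> M}),
      (forall j, fimg F n r act (m j)) ->
      wact sigma tau (t2 m)
      = t2 [ffun i => act (er F n r (pmx F n r (sigma i))) (m ((tau^-1)%g i))]) :
  (* f_{rs} M^{⊗s} ≅ F S_{rs} ⊗_{F(S_r wr S_s)} ((f_r M)^{⊗s} ⊗_F F S_s):
     a linear surjection Phi from F S_{rs} ⊗_F ((f_r M)^{⊗s} ⊗_F F S_s)
     onto f_{rs} M^{⊗s} whose kernel is exactly the span of the balancing
     relations, compatible with the left S_{rs}- and right S_s-actions *)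
  exists Phi : {ffun 'S_(r * s) * 'S_s -> T2} -> T,
    [/\ islin F Phi,
        forall u, fimg F n (r * s) actT (Phi u),
        forall y, fimg F n (r * s) actT y -> exists u, Phi u = y,
        forall u, Phi u = 0 <->
          lspan F (fun z => exists (g h : 'S_(r * s)) (sigma : {ffun 'I_s -> 'S_r})
                                  (tau k : 'S_s) (y : T2),
                     is_wr h sigma tau /\
                     z = single F (pc g h) k y - single F g (pc tau k) (wact sigma tau y)) u
      & (forall (g : 'S_(r * s)) u,
            Phi (indl F g u) = actT (er F n (r * s) (pmx F n (r * s) g)) (Phi u))
        /\ (forall (tau : 'S_s) u, Phi (indr F tau u) = rp tau (Phi u))].
Proof.
have rn : (r <= n)%N by apply: leq_trans hn; rewrite leq_pmulr.
have lE A := actE_lin Hact A.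
have [theta [theta_lin thetaE _]] := Ht2.2 T _
  (multilin_map (L := fun q => act (er F n r (pm F n (blk_in r q)))) (fun q => lE _)
     (fun _ _ _ => I) Ht.1).
have XL q : islin F
    (fun x => act (xw F (first_idx rn)) (act (er F n r (pm F n (@blk_out r s q))) x)).
  exact: islin_comp (actX_lin rn Hact) (lE _).
have [pi [pi_lin piE _]] := Ht.2 T2 _
  (multilin_map (P := fimg F n r act) (Q := fun=> True) XL
     (fun q x _ => fimgX rn act _) Ht2.1).
have piE' m := piE m (fun=> I).
exists (Phi actT rp theta); split.
- exact: Phi_lin.
- move=> u; apply/(fimgT_fix hn HactT); exact: Phi_XT thetaE u.
- move=> y; apply: Phi_surj; eassumption.
- move=> u; apply: Phi_ker; eassumption.
split; first by move=> g u; apply: Phi_indl; eassumption.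
by move=> tau u; apply: Phi_indr; eassumption.
Qed.
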